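(* Suppose that $(S, \preceq)$ is a uniform poset, and let $\boldsymbol{Y}$ be a downward run chain on $S$ with transition function $Q$ and standard invariant function $G(x) = \mathbb{P}_e(U_x \le U_e)$. Then $\mathbb{P}_e(U_e = n+1) = Q(e,S_n)$ for $n \in \mathbb{N}$, and hence $\nu(e) := \mathbb{E}_e(U_e) = \sum_{n=0}^\infty (n+1) Q(e,S_n)$; thus $\boldsymbol{Y}$ is positive recurrent if and only if this sum is finite. Moreover, $$G(x) = \sum_{y \succeq x} Q(e,y)\, Q^{d(x,y)}(y,x), \quad x \in S.$$
   Context: $(S, \preceq)$ is a discrete (countable) partially ordered set with a minimum element $e$, such that for every $x \in S$ every chain (totally ordered subset) in $S$ from $e$ to $x$ is finite. An element $y$ covers $x$ if $y$ is a minimal element of $\{t \in S : t \succ x\}$; $B_x = \{w \in S : x \text{ covers } w\}$. The covering graph is the directed graph on $S$ with an edge $(x,y)$ whenever $y$ covers $x$. The poset is uniform if for each $x \in S$ all directed paths from $e$ to $x$ in the covering graph have the same length; it then follows that for $x \preceq y$ all paths from $x$ to $y$ have the same length, denoted $d(x,y)$. $S_n = \{x \in S : d(e,x) = n\}$ for $n \in \mathbb{N} = \{0,1,2,\ldots\}$. A downward run chain is a (time-homogeneous, discrete-time) Markov chain $(Y_0, Y_1, \ldots)$ on $S$ whose transition function $Q$ satisfies $Q(x,y) > 0$ if and only if either $x = e$ and $y \in S$, or $x \in S - \{e\}$ and $y \in B_x$. $Q^n$ is the $n$-step transition function ($Q^0$ is the identity) and $Q(e,A) = \sum_{x\in A}Q(e,x)$.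 $\mathbb{P}_e$, $\mathbb{E}_e$ denote probability and expectation given $Y_0 = e$; $U_x = \min\{n \ge 1 : Y_n = x\}$. *)

(* Defs.v *)
From HB Require Import structures.
From mathcomp Require Import all_boot all_order all_algebra.
From mathcomp Require Import all_classical all_reals all_analysis.

Set Implicit Arguments.
Unset Strict Implicit.
Unset Printing Implicit Defensive.

Import Order.TTheory GRing.Theory Num.Theory.

Local Open Scope classical_set_scope.
Local Open Scope ring_scope.
Local Open Scope ereal_scope.

Definition chain_between d (S : porderType d) (a b : S) (C : set S) : Prop :=
  [/\ C a, C b, (forall z, C z -> (a <= z <= b)%O)
    & total_on C (fun x y => (x <= y)%O)].

Definition covers d (S : porderType d) (y x : S) : Prop :=
  (x < y)%O /\ forall t : S, (x < t)%O -> (t <= y)%O -> t = y.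

Definition covered_by d (S : porderType d) (x : S) : set S :=
  [set w | covers x w].

Definition cover_edge d (S : porderType d) : rel S :=
  fun x y => `[< covers y x >].

(* The path is the sequence of vertices following [x], so that [size p] is its
   number of edges. *)
Definition is_cover_path d (S : porderType d) (x y : S) (p : seq S) : Prop :=
  path (@cover_edge d S) x p /\ last x p = y.

Definition uniform_poset d (S : bPOrderType d) : Prop :=
  forall (x : S) (p q : seq S),
    is_cover_path \bot%O x p -> is_cover_path \bot%O x q -> size p = size q.

(* The common length of the covering paths from [x] to [y]; it is a junk value
   when there is no such path, i.e. unless [x <= y]. *)
Definition dist d (S : porderType d) (x y : S) : nat :=
  xget 0%N [set n | exists2 p, is_cover_path x y p & size p = n].

Definition level d (S : bPOrderType d) (n : nat) : set S :=
  [set x | dist \bot%O x = n].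
Arguments level {d} S n.

Definition transition_function (R : realType) (S : choiceType)
    (Q : S -> S -> R) : Prop :=
  (forall x y, (0 <= Q x y)%R) /\
  (forall x, \esum_(y in [set: S]) (Q x y)%:E = 1).

Definition downward_run (R : realType) d (S : bPOrderType d)
    (Q : S -> S -> R) : Prop :=
  transition_function Q /\
  forall x y : S,
    (0 < Q x y)%R <-> (x = \bot%O \/ (x <> \bot%O /\ covered_by x y)).

Fixpoint Qstep (R : realType) (S : choiceType) (Q : S -> S -> R) (n : nat)
    (x y : S) : \bar R :=
  match n with
  | 0%N => (x == y)%:R%:E
  | m.+1 => \esum_(z in [set: S]) ((Q x z)%:E * Qstep Q m z y)
  end.

Definition Qset (R : realType) (S : choiceType) (Q : S -> S -> R) (x : S)
    (A : set S) : \bar R :=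
  \esum_(y in A) (Q x y)%:E.

(* [P x] is the law of the process given [Y_0 = x].  The state space carries the
   discrete sigma-algebra.  The last clause is the time-homogeneous Markov
   property, multiplied out to avoid conditioning on null events:
   P_x(Y_n+1 = s_n+1 | Y_0 = s_0, ..., Y_n = s_n) = Q(s_n, s_n+1). *)
Definition markov_chain (R : realType) (S : choiceType) (dO : measure_display)
    (Omega : measurableType dO) (P : S -> probability Omega R)
    (Y : nat -> Omega -> S) (Q : S -> S -> R) : Prop :=
  [/\ forall n (A : set S), measurable (Y n @^-1` A),
      forall x, P x [set w | Y 0%N w = x] = 1
    & forall x n (s : nat -> S),
        P x [set w | forall k, (k <= n.+1)%N -> Y k w = s k] =
        P x [set w | forall k, (k <= n)%N -> Y k w = s k]
          * (Q (s n) (s n.+1))%:E].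

(* Equal to [+oo] when the chain never visits [x] at a positive time. *)
Definition hitting_time (R : realType) (S : choiceType) (Omega : Type)
    (Y : nat -> Omega -> S) (x : S) (w : Omega) : \bar R :=
  ereal_inf [set n%:R%:E | n in [set n : nat | (1 <= n)%N /\ Y n w = x]].

Definition mean_return_time (R : realType) (S : choiceType)
    (dO : measure_display) (Omega : measurableType dO)
    (P : S -> probability Omega R) (Y : nat -> Omega -> S) (x : S) : \bar R :=
  \int[P x]_w hitting_time R Y x w.

Definition positive_recurrent (R : realType) (S : choiceType)
    (dO : measure_display) (Omega : measurableType dO)
    (P : S -> probability Omega R) (Y : nat -> Omega -> S) : Prop :=
  forall x, mean_return_time P Y x < +oo.

Definition standard_invariant (R : realType) d (S : bPOrderType d)
    (dO : measure_display) (Omega : measurableType dO)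
    (P : S -> probability Omega R) (Y : nat -> Omega -> S) (x : S) : \bar R :=
  P \bot%O
    [set w | hitting_time R Y x w <= hitting_time R Y (\bot%O : S) w].

(* Main.v *)
Require Import Defs.
From HB Require Import structures.
From mathcomp Require Import all_boot all_order all_algebra.
From mathcomp Require Import all_classical all_reals all_analysis measurable_realfun.
From mathcomp Require Import ring.

(** Write [rank x] for the length of the covering paths from the bottom to [x].
    Off the bottom every step of the chain goes to an element covered by the
    current one, so the rank drops by exactly one; at the bottom the chain jumps
    anywhere. A path started at the bottom is therefore deterministic in its
    timing once [Y 1] is known: it first returns at time [rank (Y 1) + 1]
    ([return_time_rank]), and it visits [x] no later than this return exactly
    when [x <= Y 1] and it is at [x] at time [1 + dist x (Y 1)], the only time
    compatible with the ranks ([hit_before_return]). These facts hold almost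
    surely because almost surely only steps of positive probability are made
    ([support_ae]). Summing over the value of [Y 1] gives the law of the return
    time, its mean and the formula for the invariant function.

    The covering paths from the bottom exist because rows of [Q] sum to one:
    each element other than the bottom covers something, and an endless descent
    would be an infinite chain ([bottom_path_exists]).

    For positive recurrence, a finite mean return time [M] to the bottom has to
    bound the mean return time of every [x]. The function
    [rank z + M / Q bot x] is a Lyapunov function for the chain stopped at [x]:
    it decreases by one at each step off the bottom, and at the bottom the chance
    [Q bot x] of hitting [x] at once compensates the mean excursion length [M].
    The general bound [foster_bound] concludes. *)

Set Implicit Arguments.
Unset Strict Implicit.
Unset Printing Implicit Defensive.

Import Order.TTheory GRing.Theory Num.Theory.

Local Open Scope classical_set_scope.
Local Open Scope ring_scope.
Local Open Scope ereal_scope.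

(** * Sums and measures over a countable type *)

Section sums.
Context (R : realType) (T : choiceType).

Lemma esumZl (A : set T) (c : R) (a : T -> \bar R) :
  (0 <= c)%R -> (forall i, 0 <= a i) ->
  \esum_(i in A) (c%:E * a i) = c%:E * \esum_(i in A) a i.
Proof.
have le (b : R) (u : T -> \bar R) : (0 <= b)%R -> (forall i, 0 <= u i) ->
    \esum_(i in A) (b%:E * u i) <= b%:E * \esum_(i in A) u i.
  move=> b0 u0; apply: ge_ereal_sup => _ [X XA <-].
  rewrite -ge0_mule_fsumr//; apply: lee_wpmul2l; rewrite ?lee_fin//.
  by apply: ereal_sup_ubound; exists X.
move=> c0 a0; apply/eqP; rewrite eq_le le//=.
have [<-|cN0] := eqVneq 0%R c.
  by rewrite mul0e esum_ge0// => i _; rewrite mul0e.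
have {cN0}c0 : (0 < c)%R by rewrite lt_neqAle cN0.
have ci0 : (0 <= c^-1)%R by rewrite invr_ge0 ltW.
have ca0 i : 0 <= c%:E * a i by rewrite mule_ge0// lee_fin ltW.
have -> : \esum_(i in A) a i = \esum_(i in A) (c^-1%:E * (c%:E * a i)).
  by apply: eq_esum => i _; rewrite muleA -EFinM mulVf ?gt_eqF// mul1e.
have c0' : 0 <= c%:E by rewrite lee_fin ltW.
apply: le_trans (lee_wpmul2l c0' (le _ _ ci0 ca0)) _.
by rewrite muleA -EFinM mulfV ?gt_eqF// mul1e.
Qed.

Lemma esum_point (f : T -> \bar R) (c : T) :
  (forall i, 0 <= f i) -> (forall i, i != c -> f i = 0) ->
  \esum_(i in [set: T]) f i = f c.
Proof.
move=> f0 fc; rewrite -(esum_set1 (f0 c)) [RHS]esum_mkcond.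
apply: eq_esum => i _; case: ifPn => // /negP ic; apply: fc.
by apply/eqP => icE; apply: ic; rewrite icE inE.
Qed.

End sums.

Section measures.
Context (R : realType) (dO : measure_display) (Omega : measurableType dO).

(** Countable additivity over an arbitrary countable type, transported from
    [nat] along an injection. *)
Lemma measure_esum_fibers (mu : {measure set Omega -> \bar R}) (T : choiceType)
    (Z : Omega -> T) (B : set Omega) :
  countable [set: T] -> (forall A, measurable (Z @^-1` A)) -> measurable B ->
  mu B = \esum_(s in [set: T]) mu (B `&` Z @^-1` [set s]).
Proof.
move=> /countable_injP[f finj] mZ mB.
have BE : B = \bigcup_(k in f @` setT) (B `&` Z @^-1` (f @^-1` [set k])).
  apply/seteqP; split=> [w Bw|w [k _ []]//].
  by exists (f (Z w)) => //; exists (Z w).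
rewrite {1}BE measure_bigcup; first last.
- by move=> i j _ _ [w [[_ /= <-] [_ /= <-]]].
- by move=> k _; apply: measurableI.
rewrite nneseries_esum// set_mem_set esum_image//.
apply: eq_esum => s _; congr (mu (_ `&` _)); apply/seteqP; split => w /=.
  by apply: finj; rewrite inE.
by move=> ->.
Qed.

Lemma eq_measure_ae (mu : {measure set Omega -> \bar R}) (A B : set Omega) :
  measurable A -> measurable B ->
  {ae mu, forall w, A w <-> B w} -> mu A = mu B.
Proof.
move=> mA mB AB.
rewrite -[A]setIT -[B]setIT -!(integral_indic mu measurableT)//.
apply: ge0_ae_eq_integral => //.
- exact/measurable_EFinP/measurable_indic.
- exact/measurable_EFinP/measurable_indic.
apply: filterS AB => w ABw _; rewrite !indicE; congr ((nat_of_bool _)%:R%:E).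
by apply/idP/idP; rewrite !inE => /ABw.
Qed.

End measures.

(** * Covering paths and ranks *)

Section covering_paths.
Context (d : Order.disp_t) (S : bPOrderType d).
Implicit Types (x y w : S) (p q : seq S).

Local Notation rank := (dist (\bot%O : S)).

(** Follow a choice of covered elements downwards. If the bottom were never
    reached, the descent together with the bottom would be an infinite chain
    below [x]. *)
Lemma bottom_path_exists :
  (forall (x : S) (C : set S), chain_between \bot%O x C -> finite_set C) ->
  (forall x : S, x <> \bot%O -> exists w, covers x w) ->
  forall x : S, exists p, is_cover_path \bot%O x p.
Proof.
move=> fchain descends x.
have /choice[g gP] z : exists w : S, z <> \bot%O -> covers z w.
  have [->|/eqP zb] := eqVneq z \bot%O; first by exists \bot%O.
  by have [w zw] := descends _ zb; exists w.
have [[n]|never] := pselect (exists n, iter n g x = \bot%O).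
  elim: n x => [|n IH] x; first by move=> /= ->; exists [::].
  rewrite iterSr => /IH[p [pp lp]].
  have [->|/eqP xb] := eqVneq x \bot%O; first by exists [::].
  exists (rcons p x); split; last by rewrite last_rcons.
  by rewrite rcons_path pp lp; apply/asboolP; exact: gP.
exfalso.
pose f n := iter n g x.
have fS n : (f n.+1 < f n)%O.
  by have [] := gP (f n) (fun fn => never (ex_intro _ n fn)).
have fD m k : (f (m + k.+1)%N < f m)%O.
  elim: k => [|k IH]; first by rewrite addn1.
  by apply: lt_trans IH; rewrite addnS.
have flt m n : (m < n)%N -> (f n < f m)%O.
  by move=> mn; rewrite -(subnKC mn) addSnnS; exact: fD.
have fle m n : (m <= n)%N -> (f n <= f m)%O.
  by rewrite leq_eqVlt => /predU1P[->//|/flt/ltW].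
have finj : injective f.
  move=> m n fmn; case: (ltngtP m n) => // /flt; by rewrite fmn ltxx.
have : finite_set ([set \bot%O] `|` range f).
  apply: (fchain x); split=> [|||].
  - by left.
  - by right; exists 0%N.
  - by move=> z [->|[n _ <-]]; rewrite ?lexx le0x ?(fle 0%N).
  - move=> y z [->|[m _ <-]] [->|[n _ <-]]; rewrite ?lexx ?le0x; [by left..|by right|].
    by have [/fle ?|/ltnW/fle ?] := leqP m n; [right|left].
move=> /(sub_finite_set (@subsetUr _ _ _)).
have /eq_finite_set -> : (range f #= [set: nat])%card.
  by apply: inj_card_eq => m n _ _; exact: finj.
exact: infinite_nat.
Qed.

Lemma cover_path_le x y p : is_cover_path x y p -> (x <= y)%O.
Proof.
elim: p x => [|z p IH] x [/=]; first by move=> _ ->.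
by move=> /andP[/asboolP[/ltW xz _] pp] lp; apply: le_trans xz (IH z _).
Qed.

Hypothesis S_uniform : uniform_poset S.

Lemma rank_path y p : is_cover_path \bot%O y p -> rank y = size p.
Proof.
move=> pp; rewrite /dist.
have /(xgetPex 0%N)[q qq <-] : exists n, [set n | exists2 q : seq S,
  is_cover_path \bot%O y q & size q = n] n by exists (size p), p.
exact: S_uniform qq pp.
Qed.

Lemma rank_bot : rank \bot%O = 0%N.
Proof. by rewrite (@rank_path _ [::]). Qed.

Hypothesis bottom_path : forall x : S, exists p, is_cover_path \bot%O x p.

Lemma rank_eq0 x : rank x = 0%N -> x = \bot%O.
Proof.
by have [p pp] := bottom_path x; rewrite (rank_path pp) => /size0nil p0; case: pp; rewrite p0.
Qed.

(** Prefixing a path from [x] to [y] by one from the bottom to [x] turns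
    uniformity, which only speaks of paths from the bottom, into a statement on
    all paths. *)
Lemma rank_add x y p : is_cover_path x y p -> rank y = (rank x + size p)%N.
Proof.
move=> [pp lp]; have [q [qq lq]] := bottom_path x.
rewrite (@rank_path x q)// (@rank_path y (q ++ p)) ?size_cat//.
by split; rewrite ?cat_path ?last_cat lq// qq.
Qed.

Lemma dist_path x y p : is_cover_path x y p -> dist x y = size p.
Proof.
move=> pp; rewrite /dist.
have /(xgetPex 0%N)[q qq <-] : exists n, [set n | exists2 q : seq S,
  is_cover_path x y q & size q = n] n by exists (size p), p.
by apply: (@addnI (rank x)); rewrite -(rank_add qq) -(rank_add pp).
Qed.

Lemma rank_covers x w : covers x w -> rank x = (rank w).+1.
Proof.
move=> xw; rewrite (@rank_add w x [:: x]) ?addn1//.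
by split=> //=; rewrite andbT; apply/asboolP.
Qed.

(** When no path joins [x] to [y], the distance is the default value 0. *)
Lemma dist_le_rank x y : (dist x y <= rank y)%N.
Proof.
have [[p pp]|no] := pselect (exists p, is_cover_path x y p).
  by rewrite (dist_path pp) (rank_add pp) leq_addl.
by rewrite {1}/dist xgetPN// => n [p pp _]; apply: no; exists p.
Qed.

Section trajectory.
Variable y : nat -> S.
Hypothesis y_descends : forall n, y n = \bot%O \/ covers (y n) (y n.+1).

(** As long as fewer steps than the initial rank have been made, the trajectory
    has not reached the bottom, so each step is a descent; read backwards, the
    trajectory is a covering path. *)
Lemma trajectory_path m k : (k <= rank (y m))%N ->
  exists2 p, is_cover_path (y (m + k)%N) (y m) p & size p = k.
Proof.
elim: k => [|k IH] lek; first by exists [::] => //; rewrite addn0.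
have [p pp sp] := IH (ltnW lek).
have := rank_add pp; rewrite sp => rk.
have [y0|yc] := y_descends (m + k)%N.
  by move: lek; rewrite rk y0 rank_bot add0n ltnn.
exists (y (m + k)%N :: p); last by rewrite /= sp.
case: pp => pp lp; split=> //=; rewrite pp andbT addnS; exact/asboolP.
Qed.

Lemma trajectory_rank m k : (k <= rank (y m))%N ->
  rank (y m) = (rank (y (m + k)%N) + k)%N.
Proof. by move=> /trajectory_path[p /rank_add -> ->]. Qed.

Lemma trajectory_above_bot m k : (k < rank (y m))%N -> y (m + k)%N <> \bot%O.
Proof.
move=> lek yb; move: (lek); rewrite (trajectory_rank (ltnW lek)) yb rank_bot.
by rewrite ltnn.
Qed.

Lemma trajectory_bot m : y (m + rank (y m))%N = \bot%O.
Proof.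
by apply: rank_eq0; apply: (@addIn (rank (y m))); rewrite -trajectory_rank.
Qed.

End trajectory.
End covering_paths.

(** * Hitting times *)

Section hitting_times.
Context (R : realType) (S : choiceType) (Omega : Type) (Y : nat -> Omega -> S).
Local Notation hit := (hitting_time R Y).

Lemma hitting_time_le x w n : (0 < n)%N -> Y n w = x -> hit x w <= n%:R%:E.
Proof. by move=> n0 Yn; apply: ereal_inf_lbound; exists n. Qed.

Lemma hitting_time_first x w n : (0 < n)%N -> Y n w = x ->
  (forall k, (0 < k < n)%N -> Y k w <> x) -> hit x w = n%:R%:E.
Proof.
move=> n0 Yn first; apply/eqP; rewrite eq_le hitting_time_le//=.
apply: le_ereal_inf_tmp => _ [k [k0 Yk] <-]; rewrite lee_fin ler_nat leqNgt.
by apply/negP => kn; apply: (first k) => //; rewrite k0.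
Qed.

Variant hitting_spec x w : \bar R -> Prop :=
| HitAt n of (0 < n)%N & Y n w = x & (forall k, (0 < k < n)%N -> Y k w <> x) :
    hitting_spec x w n%:R%:E
| HitNever of (forall n, (0 < n)%N -> Y n w <> x) : hitting_spec x w +oo.

Lemma hittingP x w : hitting_spec x w (hit x w).
Proof.
have [ex|no] := pselect (exists n, (0 < n)%N && (Y n w == x)).
  case: (ex_minnP ex) => n /andP[n0 /eqP Yn] nmin.
  have first k : (0 < k < n)%N -> Y k w <> x.
    move=> /andP[k0 kn] Yk.
    by have := nmin k; rewrite k0 Yk eqxx => /(_ isT); rewrite leqNgt kn.
  by rewrite (hitting_time_first n0 Yn first); exact: HitAt.
have never n : (0 < n)%N -> Y n w <> x.
  by move=> n0 /eqP Yn; apply: no; exists n; rewrite n0.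
rewrite /hitting_time (_ : [set n : nat | _] = set0).
  by rewrite image_set0 ereal_inf0; exact: HitNever.
by apply/seteqP; split=> // n [n0 Yn]; exact: (never n).
Qed.

Definition avoids x i n : set Omega :=
  [set w | forall k, (i < k <= i + n)%N -> Y k w <> x].

(** A time is the number of instants that precede it. Besides computing the mean,
    this writes the hitting time as a series of measurable functions. *)
Lemma hitting_time_tails x w :
  hit x w = \sum_(0 <= n <oo) (\1_(avoids x 0 n) w)%:E.
Proof.
have ind0 n : 0 <= (\1_(avoids x 0 n) w)%:E :> \bar R by rewrite lee_fin.
have ind1 N : (forall k, (0 < k < N)%N -> Y k w <> x) ->
    \sum_(0 <= n < N) (\1_(avoids x 0 n) w)%:E = N%:R%:E :> \bar R.
  move=> free; rewrite -[X in X%:R%:E]subn0 -sumr_const_nat -sumEFin.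
  apply: eq_big_nat => n /andP[_ nN]; rewrite indicE mem_set// => k.
  by rewrite add0n => /andP[k0 kn]; apply: free; rewrite k0 (leq_ltn_trans kn).
case: hittingP => [n n0 Yn free|never].
  rewrite (nneseries_split 0 n)// add0n ind1// eseries0 ?adde0// => k nk _.
  rewrite indicE memNset// => /(_ n); rewrite add0n n0 nk => /(_ isT).
  exact.
apply/esym/eqyP => A A0.
have [N AN] : exists N : nat, (A <= N%:R)%R.
  by exists (Num.bound A); rewrite ltW// archi_boundP// ltW.
apply: le_trans (nneseries_lim_ge N _) => [|n _ _//].
rewrite ind1 ?lee_fin// => k /andP[k0 _]; exact: never.
Qed.

End hitting_times.

(** * Return to the bottom along a descending trajectory *)

Section return_of_trajectory.
Context (R : realType) (d : Order.disp_t) (S : bPOrderType d).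
Context (Omega : Type) (Y : nat -> Omega -> S).
Local Notation hit := (hitting_time R Y).
Local Notation rank := (dist (\bot%O : S)).

Hypothesis S_uniform : uniform_poset S.
Hypothesis bottom_path : forall x : S, exists p, is_cover_path \bot%O x p.
Variable w : Omega.
Hypothesis Y_descends :
  forall n, Y n w = \bot%O \/ covers (Y n w) (Y n.+1 w).

Let path_above := trajectory_path S_uniform bottom_path Y_descends.

Lemma return_time_rank : hit \bot%O w = (rank (Y 1%N w)).+1%:R%:E.
Proof.
apply: hitting_time_first => //.
  exact: (trajectory_bot S_uniform bottom_path Y_descends 1).
move=> [//|k]; rewrite ltnS /= => kr.
exact: (trajectory_above_bot S_uniform bottom_path Y_descends (m := 1)).
Qed.

(** Before the return to the bottom, the state at time [1 + k] lies [k] covering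
    steps below [Y 1], so [x] can be visited at no other time than
    [1 + dist x (Y 1)]. *)
Lemma hit_before_return x :
  hit x w <= hit \bot%O w <->
  (x <= Y 1%N w)%O /\ Y (1 + dist x (Y 1%N w))%N w = x.
Proof.
rewrite return_time_rank; split=> [|[_ Yx]].
  case: hittingP => [[//|n] _ Yn _|_]; last by rewrite leye_eq.
  rewrite lee_fin ler_nat ltnS => nr.
  have [p pp sp] := path_above (m := 1) nr; rewrite add1n Yn in pp.
  split; first exact: cover_path_le pp.
  by rewrite (dist_path S_uniform bottom_path pp) sp.
apply: le_trans (hitting_time_le R _ Yx) _ => //.
by rewrite lee_fin ler_nat ltnS; exact: dist_le_rank.
Qed.

End return_of_trajectory.

(** * Finite-dimensional laws of a Markov chain *)

Section markov.
Context (R : realType) (S : choiceType) (S_countable : countable [set: S]).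
Context (dO : measure_display) (Omega : measurableType dO).
Context (P : S -> probability Omega R) (Y : nat -> Omega -> S) (Q : S -> S -> R).
Hypothesis Q_transition : transition_function Q.
Hypothesis Y_chain : markov_chain P Y Q.

Let Q0 x y : (0 <= Q x y)%R. Proof. by case: Q_transition. Qed.

Lemma measurable_state n (A : set S) : measurable [set w | A (Y n w)].
Proof. by case: Y_chain => + _ _; exact. Qed.

Lemma measurable_avoids x i n : measurable (avoids Y x i n).
Proof.
rewrite (_ : avoids _ _ _ _ =
    \bigcap_(k in [set k | (i < k <= i + n)%N]) [set w | (~` [set x]) (Y k w)]).
  by apply: bigcap_measurableType => // k _; exact: measurable_state.
by apply/seteqP; split=> w Aw k /Aw.
Qed.

Lemma measurable_hitting_time x : measurable_fun setT (hitting_time R Y x).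
Proof.
rewrite (_ : hitting_time R Y x =
    fun w => \sum_(0 <= n <oo | n \in xpredT) (\1_(avoids Y x 0 n) w)%:E).
  apply: ge0_emeasurable_sum => // n _.
  exact/measurable_EFinP/measurable_indic/measurable_avoids.
by apply/funext => w; rewrite hitting_time_tails.
Qed.

Lemma measurable_hitting_time_eq x (c : \bar R) :
  measurable [set w | hitting_time R Y x w = c].
Proof.
rewrite -[X in measurable X]setTI.
exact: (measurable_hitting_time x measurableT (emeasurable_set1 c)).
Qed.

Lemma measurable_hitting_time_le x y :
  measurable [set w | hitting_time R Y x w <= hitting_time R Y y w].
Proof.
rewrite -[X in measurable X]setTI.
have mle := measurable_fun_lee (measurable_hitting_time x) (measurable_hitting_time y).
exact: (mle measurableT [set true]).
Qed.

Definition cylinder (s : nat -> S) n : set Omega :=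
  [set w | forall k, (k <= n)%N -> Y k w = s k].

Definition extend (s : nat -> S) n c : nat -> S :=
  fun k => if k == n.+1 then c else s k.

Lemma measurable_cylinder s n : measurable (cylinder s n).
Proof.
rewrite (_ : cylinder _ _ =
    \bigcap_(k in [set k | (k <= n)%N]) [set w | [set s k] (Y k w)]).
  by apply: bigcap_measurableType => // k _; exact: measurable_state.
by apply/seteqP; split=> w Aw k /Aw.
Qed.

Lemma cylinder_extend s n c :
  cylinder (extend s n c) n.+1 = cylinder s n `&` [set w | Y n.+1 w = c].
Proof.
apply/seteqP; split=> w /=.
  move=> cyl; split=> [k kn|].
    by rewrite cyl ?leqW// /extend ltn_eqF.
  by rewrite cyl// /extend eqxx.
move=> [cyl Yc] k; rewrite /extend leq_eqVlt ltnS => /orP[/eqP ->|kn].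
  by rewrite eqxx.
by rewrite ltn_eqF// cyl.
Qed.

Lemma probability_extend x s n c :
  P x (cylinder (extend s n c) n.+1) = P x (cylinder s n) * (Q (s n) c)%:E.
Proof.
case: Y_chain => _ _ /(_ x n (extend s n c)).
rewrite -/(cylinder _ _) -/(cylinder _ _) => ->.
rewrite /extend eqxx ltn_eqF//; congr (P x _ * _).
by apply/seteqP; split=> w cyl k kn; rewrite cyl// /extend ltn_eqF.
Qed.

(** The simple Markov property, in the form used by the inductions below: if,
    given a history that ends in [c], the future event [B] has probability [u c],
    then averaging over the next state gives its probability one step earlier. *)
Lemma one_step x s n (B : set Omega) (u : S -> \bar R) :
  measurable B -> (forall c, 0 <= u c) ->
  (forall c, P x (cylinder (extend s n c) n.+1 `&` B) =
             P x (cylinder (extend s n c) n.+1) * u c) ->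
  P x (cylinder s n `&` B) =
  P x (cylinder s n) * \esum_(c in [set: S]) ((Q (s n) c)%:E * u c).
Proof.
move=> mB u0 Bu; have mC := measurable_cylinder s n.
rewrite (measure_esum_fibers (P x) S_countable (measurable_state n.+1)); last first.
  exact: measurableI.
have -> : P x (cylinder s n) = (fine (P x (cylinder s n)))%:E.
  by rewrite fineK// fin_num_measure.
rewrite -esumZl; first last.
- by move=> c; rewrite mule_ge0// lee_fin.
- exact: fine_ge0.
apply: eq_esum => c _; rewrite fineK ?fin_num_measure// muleA -probability_extend.
by rewrite -Bu cylinder_extend setIAC.
Qed.

Lemma Qstep_ge0 n x y : 0 <= Qstep Q n x y.
Proof.
elim: n x => [|n IH] x /=; first by rewrite lee_fin.
by apply: esum_ge0 => z _; rewrite mule_ge0// lee_fin.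
Qed.

Lemma markov_Qstep x s n m y :
  P x (cylinder s n `&` [set w | Y (n + m)%N w = y]) =
  P x (cylinder s n) * Qstep Q m (s n) y.
Proof.
elim: m n s => [|m IH] n s.
  rewrite addn0 /=; have [<-|sy] := eqVneq.
    rewrite mule1; congr (P x _); apply/seteqP; split=> w; first by case.
    by move=> cyl; split=> //; exact: cyl.
  rewrite mule0 (_ : _ `&` _ = set0) ?measure0//; apply/seteqP; split=> w //=.
  by move=> [cyl Yy]; move/eqP: sy; apply; rewrite -cyl.
apply: one_step => [||c]; first exact: (measurable_state _ [set y]).
  by move=> c; exact: Qstep_ge0.
by rewrite addnS -addSn IH /extend eqxx.
Qed.

(** The probability, computed from the transition function alone, of not meeting
    [x] during the next [n] steps; the current state [z] may be [x] itself. *)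
Fixpoint avoidance x n z : \bar R :=
  if n is m.+1 then \esum_(c in [set: S])
    ((Q z c)%:E * (if c == x then 0 else avoidance x m c))
  else 1.

Lemma avoidance_ge0 x n z : 0 <= avoidance x n z.
Proof.
elim: n z => [|n IH] z //=.
by apply: esum_ge0 => c _; rewrite mule_ge0 ?lee_fin//; case: ifP.
Qed.

Lemma markov_avoidance x s n m y :
  P x (cylinder s n `&` avoids Y y n m) =
  P x (cylinder s n) * avoidance y m (s n).
Proof.
elim: m n s => [|m IH] n s.
  rewrite mule1; congr (P x _); apply/seteqP; split=> w; first by case.
  by move=> cyl; split=> // k; rewrite addn0 ltnNge andNb.
apply: one_step => [||c]; first exact: measurable_avoids.
  by move=> c; case: ifP => // _; exact: avoidance_ge0.
have Yc w : cylinder (extend s n c) n.+1 w -> Y n.+1 w = c.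
  by rewrite cylinder_extend => -[].
case: eqVneq => [cy|cy].
  rewrite mule0 (_ : _ `&` _ = set0) ?measure0//; apply/seteqP; split=> w //.
  move=> [/Yc Yw] /(_ n.+1); rewrite ltnSn addnS ltnS leq_addr => /(_ isT).
  by rewrite Yw.
transitivity (P x (cylinder (extend s n c) n.+1 `&` avoids Y y n.+1 m)).
  congr (P x _); apply/seteqP; split=> w [cyl av]; split=> // k.
    by rewrite addSnnS => /andP[nk km]; apply: av; rewrite km ltnW.
  move=> /andP[]; rewrite leq_eqVlt => /orP[/eqP <- _|nk km].
    by rewrite (Yc w)//; exact/eqP.
  by apply: av; rewrite nk addSnnS.
by rewrite IH /extend eqxx.
Qed.

Definition forbidden n : set Omega :=
  [set w | ~ (0 < Q (Y n w) (Y n.+1 w))%R].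

Lemma measurable_forbidden n : measurable (forbidden n).
Proof.
rewrite (_ : forbidden n = \bigcup_(a in [set: S]) ([set w | [set a] (Y n w)] `&`
    [set w | [set b | ~ (0 < Q a b)%R] (Y n.+1 w)])).
  apply: countable_bigcupT_measurable => // a.
  by apply: measurableI; exact: measurable_state.
by apply/seteqP; split=> [w nQ|w [a _ [/= <-]]//]; exists (Y n w).
Qed.

(** Transitions of zero probability are negligible, after every given history. *)
Lemma markov_forbidden x s n m :
  P x (cylinder s n `&` forbidden (n + m)) = 0.
Proof.
elim: m n s => [|m IH] n s.
  rewrite addn0 (@one_step _ _ _ _ (fun c => if (0 < Q (s n) c)%R then 0 else 1)).
  - rewrite esum1 ?mule0// => c _; case: ifPn => [_|]; first by rewrite mule0.
    by rewrite -leNgt => Qle; rewrite (le_anti (introT andP (conj Qle (Q0 _ _)))) mul0e.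
  - exact: measurable_forbidden.
  - by move=> c; case: ifP.
  - move=> c; have Yc w : cylinder (extend s n c) n.+1 w ->
        Y n w = s n /\ Y n.+1 w = c.
      by rewrite cylinder_extend => -[cyl ->]; rewrite cyl.
    case: ifP => Qc.
      rewrite mule0 (_ : _ `&` _ = set0) ?measure0//; apply/seteqP; split=> w //.
      by move=> [/Yc[Yn Yn1]] /=; rewrite /forbidden /= Yn Yn1.
    rewrite mule1; congr (P x _); apply/seteqP; split=> w; first by case.
    move=> cyl; split=> //; rewrite /forbidden /=.
    by have [-> ->] := Yc w cyl; rewrite Qc.
rewrite (@one_step _ _ _ _ (fun=> 0)) ?esum1 ?mule0//.
- by move=> c _; rewrite mule0.
- exact: measurable_forbidden.
- by move=> c; rewrite addnS -addSn IH mule0.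
Qed.

Lemma initial_cylinder x : P x (cylinder (fun=> x) 0) = 1.
Proof.
case: Y_chain => _ + _ => /(_ x) <-; congr (P x _).
by apply/seteqP; split=> w /=; [exact|move=> Yx [|//]].
Qed.

Lemma initial_ae x : {ae P x, forall w, Y 0%N w = x}.
Proof.
exists (~` cylinder (fun=> x) 0); split.
- exact/measurableC/measurable_cylinder.
- rewrite probability_setC ?initial_cylinder ?subee//.
  exact: measurable_cylinder.
- by move=> w Yx cyl; apply: Yx; exact: cyl.
Qed.

Lemma probability_initial x (B : set Omega) : measurable B ->
  P x B = P x (cylinder (fun=> x) 0 `&` B).
Proof.
move=> mB; have mC := measurable_cylinder (fun=> x) 0.
apply: eq_measure_ae => //; first exact: measurableI.
apply: filterS (initial_ae x) => w Yx; split=> [Bw|[]//].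
by split=> // -[|//] _.
Qed.

Lemma support_ae x :
  {ae P x, forall w, forall n, (0 < Q (Y n w) (Y n.+1 w))%R}.
Proof.
apply: ae_foralln => n; exists (forbidden n); split=> //.
  exact: measurable_forbidden.
have : P x (forbidden n) = 0; last exact.
rewrite probability_initial; last exact: measurable_forbidden.
exact: (markov_forbidden x _ 0 n).
Qed.

Lemma probability_state1 x y : P x [set w | Y 1%N w = y] = (Q x y)%:E.
Proof.
rewrite probability_initial; last exact: (measurable_state 1 [set y]).
rewrite -cylinder_extend probability_extend.
by rewrite initial_cylinder mul1e.
Qed.

Lemma probability_state1_later x y z m :
  P x [set w | Y 1%N w = y /\ Y (1 + m)%N w = z] = (Q x y)%:E * Qstep Q m y z.
Proof.
rewrite probability_initial; last first.
  by apply: measurableI; exact: (measurable_state _ [set _]).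
rewrite (_ : [set w | _] = [set w | Y 1%N w = y] `&` [set w | Y (1 + m)%N w = z])//.
rewrite setIA -cylinder_extend markov_Qstep probability_extend.
by rewrite initial_cylinder mul1e.
Qed.

Lemma probability_avoids x y n : P x (avoids Y y 0 n) = avoidance y n x.
Proof.
rewrite probability_initial; last exact: measurable_avoids.
by rewrite markov_avoidance initial_cylinder mul1e.
Qed.

Lemma mean_return_time_tails x :
  mean_return_time P Y x = \sum_(0 <= n <oo) avoidance x n x.
Proof.
rewrite /mean_return_time.
under eq_integral do rewrite hitting_time_tails.
rewrite integral_nneseries//; last first.
  by move=> n; exact/measurable_EFinP/measurable_indic/measurable_avoids.
apply: eq_eseriesr => n _; rewrite integral_indic ?setIT//.
  exact: probability_avoids.
exact: measurable_avoids.
Qed.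

(** If [h] pays for one unit of time plus its own expected value after the next
    step, the visit to [x] being free of charge, then by induction it pays for
    any number of steps made before the first visit. *)
Lemma foster_bound x (h : S -> \bar R) : (forall z, 0 <= h z) ->
  (forall z, 1 + \esum_(c in [set: S])
     ((Q z c)%:E * (if c == x then 0 else h c)) <= h z) ->
  mean_return_time P Y x <= h x.
Proof.
move=> h0 hx; rewrite mean_return_time_tails.
have bound N z : \sum_(0 <= n < N) avoidance x n z <= h z.
  elim: N z => [|N IH] z; first by rewrite big_nil.
  rewrite big_nat_recl//; apply: le_trans (hx z); apply: leeD => //=.
  rewrite -esum_sum; last first.
    by move=> c n _ _; rewrite mule_ge0 ?lee_fin//; case: ifP => // _; exact: avoidance_ge0.
  apply: le_esum => c _; rewrite -ge0_sume_distrr; last first.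
    by move=> n _; case: ifP => // _; exact: avoidance_ge0.
  apply: lee_wpmul2l; first by rewrite lee_fin.
  by case: ifP => [_|_]; [rewrite big1|exact: IH].
apply: lime_le; last by apply: nearW => N; exact: bound.
by apply: is_cvg_nneseries => n _ _; exact: avoidance_ge0.
Qed.

End markov.

(** * Downward run chains *)

Section downward_run_chains.
Context (R : realType) (d : Order.disp_t) (S : bPOrderType d).
Context (S_countable : countable [set: S]).
Context (dO : measure_display) (Omega : measurableType dO).
Context (P : S -> probability Omega R) (Y : nat -> Omega -> S) (Q : S -> S -> R).
Hypothesis S_chains : forall (x : S) (C : set S),
  chain_between \bot%O x C -> finite_set C.
Hypothesis S_uniform : uniform_poset S.
Hypothesis Q_downward : downward_run Q.
Hypothesis Y_chain : markov_chain P Y Q.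

Local Notation rank := (dist (\bot%O : S)).
Local Notation hit := (hitting_time R Y).

Let Q_transition : transition_function Q. Proof. by case: Q_downward. Qed.
Let Q_ge0 x y : 0 <= (Q x y)%:E. Proof. by rewrite lee_fin Q_transition.1. Qed.
Let Q_sum1 x : \esum_(y in [set: S]) (Q x y)%:E = 1.
Proof. exact: Q_transition.2. Qed.

Lemma Q_descends x y : (0 < Q x y)%R -> x = \bot%O \/ covers x y.
Proof. by case: Q_downward => _ Qpos /Qpos[?|[_ ?]]; [left|right]. Qed.

Lemma Q_eq0 x y : x <> \bot%O -> ~ covers x y -> Q x y = 0%R.
Proof.
move=> xb nxy; apply/eqP; rewrite eq_le Q_transition.1 andbT leNgt.
by apply/negP => /Q_descends[].
Qed.

(** Otherwise the row of [Q] at [x] would vanish. *)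
Lemma covers_exists (x : S) : x <> \bot%O -> exists w, covers x w.
Proof.
move=> xb; apply: contrapT => nxy.
have := Q_sum1 x; rewrite esum1; first by move/eqP; rewrite eq_sym onee_eq0.
by move=> y _; rewrite Q_eq0// => xy; apply: nxy; exists y.
Qed.

Let bottom_path := bottom_path_exists S_chains covers_exists.

Lemma trajectory_ae x :
  {ae P x, forall w, forall n, Y n w = \bot%O \/ covers (Y n w) (Y n.+1 w)}.
Proof.
apply: filterS (support_ae S_countable Q_transition Y_chain x) => w Qw n.
exact: Q_descends.
Qed.

Lemma return_time_law n :
  P \bot%O [set w | hit \bot%O w = n.+1%:R%:E] = Qset Q \bot%O (level S n).
Proof.
rewrite (eq_measure_ae (B := [set w | level S n (Y 1%N w)])); first last.
- apply: filterS (trajectory_ae \bot%O) => w yw.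
  rewrite /= (return_time_rank R S_uniform bottom_path yw) /level /=.
  by split=> [[/eqP]|->//]; rewrite eqr_nat => /eqP[].
- exact: (measurable_state Y_chain 1 (level S n)).
- exact: measurable_hitting_time_eq Y_chain _ _.
rewrite (measure_esum_fibers _ S_countable (measurable_state Y_chain 1)); last first.
  exact: (measurable_state Y_chain 1 (level S n)).
rewrite /Qset [RHS]esum_mkcond; apply: eq_esum => y _.
rewrite -(probability_state1 Y_chain).
case: ifPn => [/set_mem yn|yn].
  congr (P _ _); apply/seteqP; split=> w /=; first by case.
  by move=> Yy; split=> //; rewrite /= Yy.
rewrite (_ : _ `&` _ = set0) ?measure0//; apply/seteqP; split=> w //= -[+ Yy].
by rewrite Yy => /mem_set yn'; rewrite yn' in yn.
Qed.

Lemma mean_return_time_bot :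
  mean_return_time P Y \bot%O =
  \sum_(0 <= n <oo) (n.+1%:R%:E * Qset Q \bot%O (level S n)).
Proof.
pose B n : set Omega := [set w | hit \bot%O w = n.+1%:R%:E].
have mB n : measurable (B n) by exact: measurable_hitting_time_eq Y_chain _ _.
have mT n : measurable_fun setT (fun w => n.+1%:R%:E * (\1_(B n) w)%:E : \bar R).
  by apply: emeasurable_funM => //; exact/measurable_EFinP/measurable_indic.
have T0 n w : 0 <= n.+1%:R%:E * (\1_(B n) w)%:E :> \bar R.
  by rewrite mule_ge0// lee_fin.
rewrite /mean_return_time (@ge0_ae_eq_integral _ _ _ (P \bot%O) _ _
    (fun w => \sum_(0 <= n <oo) (n.+1%:R%:E * (\1_(B n) w)%:E)))//; first last.
- apply: filterS (trajectory_ae \bot%O) => w yw _.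
  have hw := return_time_rank R S_uniform bottom_path yw.
  rewrite nneseries_esumT// (@esum_point _ _ _ (rank (Y 1%N w))).
  + by rewrite indicE mem_set ?mule1.
  + by move=> n; exact: T0.
  + move=> n nr; rewrite indicE memNset ?mule0// /B /= hw => -[/eqP].
    by rewrite eqr_nat eqSS eq_sym (negbTE nr).
- by move=> w _; exact: nneseries_ge0.
- by move=> w _; rewrite hitting_time_tails; apply: nneseries_ge0 => n _ _; rewrite lee_fin.
- exact: (ge0_emeasurable_sum (P := xpredT)).
- exact: measurable_hitting_time Y_chain _.
rewrite integral_nneseries//; apply: eq_eseriesr => n _.
rewrite ge0_integralZl//.
- rewrite integral_indic// setIT; congr (_ * _); exact: return_time_law.
- exact/measurable_EFinP/measurable_indic.
Qed.

(** The levels partition the poset, so the series can be summed point by point. *)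
Lemma mean_return_time_rank :
  mean_return_time P Y \bot%O =
  \esum_(y in [set: S]) ((Q \bot%O y)%:E * (rank y).+1%:R%:E).
Proof.
rewrite mean_return_time_bot.
have -> : [set: S] = \bigcup_n level S n.
  by apply/seteqP; split=> // y _; exists (rank y).
rewrite nneseries_sum_bigcup; first last.
- by move=> y; rewrite mule_ge0.
- by move=> i j _ _ [y [<- <-]].
apply: eq_eseriesr => n _; rewrite /Qset -esumZl//.
by apply: eq_esum => y <-; rewrite muleC.
Qed.

(** Foster's criterion for the Lyapunov function [h z = rank z + C], where
    [C = M / Q bot x] is chosen so that at the bottom the saving [Q bot x * C]
    made by stopping at [x] pays for the mean excursion length [M]. *)
Lemma mean_return_time_finite x :
  mean_return_time P Y \bot%O < +oo -> mean_return_time P Y x < +oo.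
Proof.
rewrite mean_return_time_rank => Mfin.
set M := \esum_(y in _) _ in Mfin.
have M0 : 0 <= M by apply: esum_ge0 => y _; rewrite mule_ge0.
have MfinE : M \is a fin_num by rewrite ge0_fin_numE.
pose q := Q \bot%O x.
have q0 : (0 < q)%R by apply/(Q_downward.2 _ _).2; left.
pose C := (fine M / q)%R.
have C0 : (0 <= C)%R by rewrite divr_ge0 ?fine_ge0// ltW.
pose h z : \bar R := ((rank z)%:R + C)%:E.
have h0 z : 0 <= h z by rewrite lee_fin addr_ge0.
apply: le_lt_trans (ltry ((rank x)%:R + C)).
apply: (foster_bound S_countable Q_transition Y_chain (h := h)) => // z.
have Qc0 y c : 0 <= (Q y c)%:E * (if c == x then 0 else h c).
  by rewrite mule_ge0//; case: ifP.
have [->|/eqP zb] := eqVneq z \bot%O.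
  set A := \esum_(c in _) _.
  (* Stopping at [x] saves at least [C] on the event that [x] is hit at once. *)
  have hA : A + q%:E * C%:E <= \esum_(c in [set: S]) ((Q \bot%O c)%:E * h c).
    have hx0 c : 0 <= (if c == x then (Q \bot%O c)%:E * h c else 0).
      by case: ifP => // _; rewrite mule_ge0.
    apply: (@le_trans _ _ (A +
        \esum_(c in [set: S]) (if c == x then (Q \bot%O c)%:E * h c else 0))).
      rewrite leeD2l// (@esum_point _ _ _ x)// ?eqxx; last by move=> c /negPf ->.
      by rewrite lee_wpmul2l// lee_fin; [exact: ltW|rewrite lerDr].
    rewrite -esumD//; apply: le_esum => c _.
    by case: ifP => _; rewrite ?mule0 ?add0e ?adde0.
  (* The mean rank of the next state is one less than the mean return time. *)
  have hM : 1 + \esum_(c in [set: S]) ((Q \bot%O c)%:E * h c) = M + C%:E.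
    rewrite -[in LHS](Q_sum1 \bot%O) -esumD//; last by move=> c _; rewrite mule_ge0.
    rewrite -[C%:E]mule1 -(Q_sum1 \bot%O) -esumZl// -esumD//; first last.
    + by move=> c _; rewrite mule_ge0// lee_fin.
    + by move=> c _; rewrite mule_ge0.
    apply: eq_esum => c _; rewrite /h -EFinD -!EFinM -EFinD; congr _%:E.
    by rewrite -[(rank c).+1]addn1 natrD; ring.
  have qC : q%:E * C%:E = M.
    by rewrite -EFinM /C mulrC divfK ?gt_eqF// fineK.
  rewrite /h (rank_bot S_uniform) add0r -(leeD2lE _ _ MfinE) -hM addeCA.
  by rewrite leeD2l// addeC -qC.
have -> : h z = 1 + ((rank z)%:R + C - 1)%:E.
  by rewrite -EFinD addrC subrK.
rewrite leeD2l//.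
(* Off the bottom [h z >= 1], as [z] covers something and so has positive rank. *)
have [w zw] := covers_exists zb.
have hz0 : (0 <= (rank z)%:R + C - 1)%R.
  by rewrite (rank_covers S_uniform bottom_path zw) -addn1 natrD addrAC addrK addr_ge0.
rewrite -[leRHS]mule1 -(Q_sum1 z) -esumZl//; apply: le_esum => c _.
have [zc|nzc] := pselect (covers z c); last by rewrite Q_eq0// mul0e mule0.
rewrite muleC lee_wpmul2r//; case: ifP => _; first by rewrite lee_fin.
by rewrite lee_fin (rank_covers S_uniform bottom_path zc) -addn1 natrD addrAC addrK.
Qed.

(** Decompose according to [Y 1 = y]; the events are disjoint and each has the
    probability of a jump to [y] followed by [dist x y] steps from [y] to [x]. *)
Lemma standard_invariant_formula x :
  standard_invariant P Y x =
  \esum_(y in [set y : S | (x <= y)%O])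
    ((Q \bot%O y)%:E * Qstep Q (dist x y) y x).
Proof.
pose B : set Omega := \bigcup_(y in [set y : S | (x <= y)%O])
  ([set w | [set y] (Y 1%N w)] `&` [set w | [set x] (Y (1 + dist x y)%N w)]).
have mB : measurable B.
  rewrite /B bigcup_mkcond; apply: countable_bigcupT_measurable => // y.
  by case: ifP => // _; apply: measurableI; exact: (measurable_state Y_chain).
rewrite /standard_invariant (eq_measure_ae (B := B))//; first last.
- apply: filterS (trajectory_ae \bot%O) => w yw.
  apply: iff_trans (hit_before_return R S_uniform bottom_path yw x) _.
  split=> [[xY Yx]|[y /= xy [/= -> Yx]]//].
  by exists (Y 1%N w).
- exact: measurable_hitting_time_le Y_chain _ _.
rewrite (measure_esum_fibers _ S_countable (measurable_state Y_chain 1) mB).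
rewrite [RHS]esum_mkcond; apply: eq_esum => y _.
case: ifPn => [/set_mem/= xy|xy].
  rewrite -(probability_state1_later S_countable Q_transition Y_chain)//.
  congr (P _ _); apply/seteqP; split=> w /=.
    by move=> [[z xz [/= Yz Yx]] Yy]; split=> //; rewrite -Yy Yz.
  by move=> [Yy Yx]; split=> //; exists y.
rewrite (_ : _ `&` _ = set0) ?measure0//; apply/seteqP; split=> w //=.
move=> [[z /= xz [/= Yz _]] Yy]; move/negP: xy; apply.
by rewrite inE /= -Yy Yz.
Qed.

End downward_run_chains.

Theorem mainTheorem13
  (R : realType)
  (d : Order.disp_t) (S : bPOrderType d)
  (S_countable : countable [set: S])
  (S_chains : forall (x : S) (C : set S),
     chain_between \bot%O x C -> finite_set C)
  (S_uniform : uniform_poset S)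
  (dO : measure_display) (Omega : measurableType dO)
  (P : S -> probability Omega R) (Y : nat -> Omega -> S) (Q : S -> S -> R)
  (Q_downward : downward_run Q)
  (Y_chain : markov_chain P Y Q) :
  [/\ forall n : nat,
        P \bot%O [set w | hitting_time R Y (\bot%O : S) w = n.+1%:R%:E]
        = Qset Q \bot%O (level S n),
      mean_return_time P Y \bot%O
        = \sum_(0 <= n <oo) (n.+1%:R%:E * Qset Q \bot%O (level S n)),
      positive_recurrent P Y <->
        \sum_(0 <= n <oo) (n.+1%:R%:E * Qset Q \bot%O (level S n)) < +oo
    & forall x : S,
        standard_invariant P Y x
        = \esum_(y in [set y : S | (x <= y)%O])
            ((Q \bot%O y)%:E * Qstep Q (dist x y) y x)].
Proof.
split.
- by move=> n; apply: return_time_law Y_chain n.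
- exact: mean_return_time_bot Y_chain.
- have <- := mean_return_time_bot S_countable S_chains S_uniform Q_downward Y_chain.
  split=> [|fin x]; first exact.
  exact: mean_return_time_finite Y_chain x fin.
- by move=> x; apply: standard_invariant_formula Y_chain x.
Qed.
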